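(* Let $k\ge 1$, let $\mathcal{M}_1,\dots,\mathcal{M}_k$ be loopless matroids on the same finite ground set $V$, let $\mathcal{C}=\bigcap_{i=1}^k\mathcal{M}_i$, and let $w\in\mathbb{R}^V_{\ge 0}$. Then $$\chi^*(\mathcal{C},w)\le k\max_{1\le i\le k}\chi^*(\mathcal{M}_i,w).$$
   Context: A complex on a finite set $V$ is a non-empty family of subsets of $V$ closed under taking subsets; a matroid is identified with the complex of its independent sets; loopless means every singleton is independent. For a complex $\mathcal{C}$ on $V$ and $w\in\mathbb{R}^V_{\ge 0}$, a $w$-fractional coloring of $\mathcal{C}$ is a function $f:\mathcal{C}\to\mathbb{R}_{\ge 0}$ with $\sum_{S\in\mathcal{C}:v\in S}f(S)\ge w(v)$ for every $v\in V$; $\chi^*(\mathcal{C},w)$ is the minimum of $\sum_{S\in\mathcal{C}}f(S)$ over all $w$-fractional colorings $f$. *)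

(* Defs.v *)
From HB Require Import structures.
From mathcomp Require Import all_boot all_order all_algebra.
From mathcomp Require Import boolp classical_sets reals topology normedtype derive.

Set Implicit Arguments.
Unset Strict Implicit.
Unset Printing Implicit Defensive.

Import Order.TTheory GRing.Theory Num.Theory.
Import numFieldTopology.Exports numFieldNormedType.Exports.

Local Open Scope ring_scope.

Section Complexes.
Variable V : finType.

Definition is_complex (C : {set {set V}}) : Prop :=
  C != finset.set0 /\
  (forall S T : {set V}, T \subset S -> S \in C -> T \in C).

Definition is_matroid (M : {set {set V}}) : Prop :=
  is_complex M /\
  (forall I J : {set V}, I \in M -> J \in M -> (#|I| < #|J|)%N ->
     exists2 x : V, x \in (J :\: I)%SET & (x |: I)%SET \in M).

Definition loopless (C : {set {set V}}) : Prop :=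
  forall v : V, [set v]%SET \in C.

End Complexes.

Section FractionalColoring.
Variables (R : realType) (V : finType).

(* A function C -> R is encoded by f : {set V} -> R whose values outside of C *)
(* do not matter.                                                             *)
Definition frac_coloring (C : {set {set V}}) (w : V -> R) (f : {set V} -> R) :
    Prop :=
  (forall S : {set V}, S \in C -> 0 <= f S) /\
  (forall v : V, w v <= \sum_(S in C | v \in S) f S).

Definition weight (C : {set {set V}}) (f : {set V} -> R) : R :=
  \sum_(S in C) f S.

(* The infimum is a minimum as soon as some coloring exists, in particular    *)
(* when C is loopless: see chi_star_min and loopless_frac_coloring.           *)
Definition chi_star (C : {set {set V}}) (w : V -> R) : R :=
  inf [set weight C f | f in [set f | frac_coloring C w f]]%classic.

Lemma weight_ge0 (C : {set {set V}}) (w : V -> R) (f : {set V} -> R) :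
  frac_coloring C w f -> 0 <= weight C f.
Proof. by case=> f0 _; apply: sumr_ge0 => S; apply: f0. Qed.

(* Hence the maximum of finitely many (at least one) values of chi_star is    *)
(* \big[Num.max/0].                                                           *)
Lemma chi_star_ge0 (C : {set {set V}}) (w : V -> R) : 0 <= chi_star C w.
Proof.
rewrite /chi_star; set A := (X in inf X).
have [[x Ax]|A0] := pselect (A !=set0)%classic.
  by apply: lb_le_inf; [exists x | move=> _ [f fC <-]; apply: weight_ge0 fC].
by rewrite inf_out// => -[].
Qed.

Let sum_continuous (P : pred {set V}) : continuous
  (fun f : prod_topology (fun _ : {set V} => R) => \sum_(S | P S) f S : R).
Proof.
apply: (@continuous_big R {set V} +%R 0 P _ _ (index_enum _)
  (fun S (f : prod_topology (fun _ : {set V} => R)) => f S : R)) => [|S _].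
  exact: (@add_continuous R).
exact: (@proj_continuous _ (fun _ : {set V} => (R : topologicalType)) S).
Qed.

Lemma chi_star_min (C : {set {set V}}) (w : V -> R) (f0 : {set V} -> R) :
  frac_coloring C w f0 ->
  exists f, [/\ frac_coloring C w f, weight C f = chi_star C w &
    forall g, frac_coloring C w g -> chi_star C w <= weight C g].
Proof.
move=> f0C; set B := weight C f0.
pose tr (f : {set V} -> R) S := if S \in C then f S else 0.
have wtr f : weight C (tr f) = weight C f.
  by apply: eq_bigr => S SC; rewrite /tr SC.
have trC f : frac_coloring C w f -> frac_coloring C w (tr f).
  move=> [f_ge0 fw]; split=> [S SC|v]; first by rewrite /tr SC f_ge0.
  apply: le_trans (fw v) _; rewrite le_eqVlt; apply/orP; left; apply/eqP.
  by apply: eq_bigr => S /andP[SC _]; rewrite /tr SC.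
pose box : set (prod_topology (fun _ : {set V} => R)) :=
  [set f | forall S, `[0, B]%classic (f S)]%classic.
pose cov : set (prod_topology (fun _ : {set V} => R)) :=
  [set f | forall v, w v <= \sum_(S in C | v \in S) f S]%classic.
have box_compact : compact box.
  apply: (@tychonoff _ (fun _ => R) (fun=> `[0, B]%classic)) => _.
  exact: segment_compact.
have cov_closed : closed cov.
  have -> : cov = (\bigcap_v [set f : prod_topology (fun _ : {set V} => R) |
      w v <= \sum_(S in C | v \in S) f S])%classic.
    by apply/seteqP; split=> [f fw v _|f fw v]; apply: fw.
  apply: closed_bigI => v _.
  by apply: closed_comp (@closed_ge R (w v)) => f _; apply: sum_continuous.
have K_compact : compact (box `&` cov)%classic.
  exact: compact_closedI.
have trK f : frac_coloring C w f -> weight C f <= B -> (box `&` cov)%classic (tr f).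
  move=> fC fB; have [tf_ge0 tfw] := trC _ fC; split=> // S /=.
  rewrite in_itv /= /tr; case: ifPn => SC.
    have f_ge0 := fC.1; rewrite f_ge0 //=; apply: le_trans fB.
    rewrite /weight (bigD1 S) //= lerDl; apply: sumr_ge0 => T /andP[TC _].
    exact: f_ge0.
  by rewrite lexx (weight_ge0 f0C).
have K_neq0 : (box `&` cov !=set0)%classic by exists (tr f0); apply: trK.
have [f /set_mem[fbox fcov] fmin] := compact_EVT_min K_neq0 K_compact
  (continuous_subspaceT (@sum_continuous (mem C))).
have fC : frac_coloring C w f.
  by split=> // S _; have := fbox S; rewrite /= in_itv /= => /andP[].
have {}fmin g : frac_coloring C w g -> weight C f <= weight C g.
  move=> gC; have [gB|/ltW Bg] := lerP (weight C g) B.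
    by rewrite -(wtr g); apply: fmin; apply/mem_set/trK.
  apply: le_trans Bg; rewrite /B -(wtr f0); apply: fmin; apply/mem_set.
  exact: trK.
have fE : weight C f = chi_star C w.
  apply/eqP; rewrite eq_le; apply/andP; split.
    apply: lb_le_inf; first by exists (weight C f), f.
    by move=> _ [g gC <-]; apply: fmin.
  apply: ge_inf; last by exists f.
  by exists 0 => _ [g gC <-]; apply: weight_ge0 gC.
by exists f; split=> // g; rewrite -fE; apply: fmin.
Qed.

Lemma loopless_frac_coloring (C : {set {set V}}) (w : V -> R) :
  (forall v, 0 <= w v) -> loopless C -> exists f, frac_coloring C w f.
Proof.
move=> w_ge0 Cl; exists (fun S : {set V} => \sum_(v in S) w v).
split=> [S _|v]; first exact: sumr_ge0.
rewrite (bigD1 [set v]%SET) ?Cl ?inE //= big_set1 lerDl.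
by apply: sumr_ge0 => S _; apply: sumr_ge0.
Qed.

End FractionalColoring.

(* Main.v *)
Require Import Defs.
From mathcomp Require Import all_boot all_order all_algebra reals.
From mathcomp Require Import ring lra.
From mathcomp Require boolp classical_sets topology normedtype derive realfun.

Import Order.TTheory GRing.Theory Num.Theory.
Local Open Scope ring_scope.

(** Let C be the common independent sets, lam the maximum of the fractional
    chromatic numbers and mu = k * lam.  By linear programming duality
    ([chi_star_le_dual]) it is enough to find, for every y >= 0, a set S in C
    with sum_v y v * w v <= mu * y(S).  The greedy algorithm, run through V by
    decreasing y, finds such an S.

    The reason is that after any number of steps the set S built so far is
    maximal in C inside the set T of elements already seen.  Each element
    of T \ S is then blocked by some matroid M i, so T is covered by k sets U i
    in which S has maximum rank for M i.  A fractional coloring of M i has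
    color classes that meet U i in at most #|S| elements, and total weight at
    most lam, so w(U i) <= lam * #|S| ([chi_star_rank_bound]), and
    w(T) <= mu * #|S| ([maximal_common_bound]).  These inequalities, one for each
    prefix T of the order, add up with the successive differences of y as
    coefficients to the required bound ([greedy_bound]). *)

Set Implicit Arguments.
Unset Strict Implicit.

(** * Linear programming duality for fractional colorings *)

Section Duality.
Import boolp classical_sets topology normedtype derive realfun.
Import numFieldTopology.Exports numFieldNormedType.Exports.
Variables (R : realType) (V : finType).
Implicit Types (C M : {set {set V}}) (S T U : {set V}) (w y : V -> R).
Implicit Types (f : {set V} -> R) (mu : R).

Local Notation fspace := (prod_topology (fun _ : {set V} => R)).

Lemma continuous_sum_coord (P : pred {set V}) :
  continuous (fun f : fspace => \sum_(S | P S) f S : R).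
Proof.
apply: (@continuous_big R {set V} +%R 0 P _ _ (index_enum _)
  (fun S (f : fspace) => f S : R)) => [|S _].
  exact: (@add_continuous R).
exact: (@proj_continuous _ (fun _ : {set V} => (R : topologicalType)) S).
Qed.

Definition covered C f v : R := \sum_(S in C | v \in S) f S.

Definition deficit C w f v : R := Num.max 0 (w v - covered C f v).

Lemma continuous_sum_sqr_deficit C w :
  continuous (fun f : fspace => \sum_v deficit C w f v ^+ 2 : R).
Proof.
have dc v : continuous (fun f : fspace => deficit C w f v : R).
  move=> f; apply: (@continuous_max R fspace (fun=> 0)); first exact: cst_continuous.
  by apply: continuousB; [exact: cst_continuous | exact: continuous_sum_coord].
apply: (@continuous_big R V +%R 0 xpredT _ _ (index_enum _)
  (fun v (f : fspace) => deficit C w f v ^+ 2 : R)) => [|v _ f].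
  exact: (@add_continuous R).
exact: (continuous_comp (dc v f) (@exprn_continuous R 2 _)).
Qed.

(** The functions with values in [0, mu] and weight at most mu form a compact
    convex set.  The pointwise bound is what makes it compact, since the weight
    does not control the values of f outside of C. *)
Lemma exists_min_deficit C w mu : 0 <= mu ->
  exists f, [/\ forall S, 0 <= f S, forall S, f S <= mu, weight C f <= mu &
    forall g, (forall S, 0 <= g S) -> (forall S, g S <= mu) ->
      weight C g <= mu ->
      \sum_v deficit C w f v ^+ 2 <= \sum_v deficit C w g v ^+ 2].
Proof.
move=> mu0.
pose box : set fspace := [set f | forall S, `[0, mu]%classic (f S)]%classic.
pose light : set fspace := [set f | weight C f <= mu]%classic.
have box_compact : compact box.
  apply: (@tychonoff _ (fun _ => R) (fun=> `[0, mu]%classic)) => _.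
  exact: segment_compact.
have light_closed : closed light.
  apply: preimage_closed (@closed_le R mu) => f _.
  exact: continuous_sum_coord.
have K_compact : compact (box `&` light)%classic by exact: compact_closedI.
have K_neq0 : (box `&` light !=set0)%classic.
  exists (fun=> 0); split=> [S|] /=; first by rewrite in_itv /= lexx.
  by rewrite /light /= /weight big1.
have [f /set_mem[fbox flight] fmin] := compact_EVT_min K_neq0 K_compact
  (continuous_subspaceT (@continuous_sum_sqr_deficit C w)).
exists f; split=> // [S|S|g g0 gmu gw].
- by have := fbox S; rewrite /= in_itv /= => /andP[].
- by have := fbox S; rewrite /= in_itv /= => /andP[].
apply: fmin; apply/mem_set; split=> // S /=.
by rewrite in_itv /= g0 gmu.
Qed.

(** The nontrivial half of duality, by separation: take f of weight at most mu
    whose vector y of deficits has the least Euclidean norm.  If y is not 0, it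
    defines a hyperplane that separates w from all vectors covered with weight
    at most mu.  Indeed, for S in C, moving f slightly towards mu times the
    indicator of S cannot decrease the norm of the deficit, so
    mu * y(S) <= sum_v y v * covered C f v, which is
    sum_v y v * w v - sum_v y v ^+ 2; the S provided for y contradicts this. *)
Lemma chi_star_le_dual C w mu : 0 <= mu ->
  (forall y, (forall v, 0 <= y v) ->
     exists2 S, S \in C & \sum_v y v * w v <= mu * \sum_(v in S) y v) ->
  chi_star C w <= mu.
Proof.
move=> mu0 dual; have [f [f0 fmu fw fmin]] := exists_min_deficit C w mu0.
pose y := deficit C w f; pose N := \sum_v y v ^+ 2.
have N0 : 0 <= N by apply: sumr_ge0 => v _; apply: sqr_ge0.
have [Npos|Nle] := ltrP 0 N; last first.
  have {Nle} /eqP : N = 0 by apply/le_anti; rewrite Nle.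
  rewrite psumr_eq0 => [/allP yz|v _]; last exact: sqr_ge0.
  have fC : frac_coloring C w f.
    split=> // v; have := yz v (mem_index_enum v).
    rewrite /= sqrf_eq0 /y /deficit => /eqP yv0; rewrite -subr_le0.
    by rewrite -[leRHS]yv0 le_max lexx orbT.
  apply: le_trans fw; apply: ge_inf; last by exists f.
  by exists 0 => _ [g gC <-]; apply: weight_ge0 gC.
have y0 v : 0 <= y v by rewrite /y /deficit le_max lexx.
have [S SC yS] := dual y y0.
(* The change of the coverage on the segment from f to mu times S. *)
pose d v : R := mu * (v \in S)%:R - covered C f v.
pose D := \sum_v d v ^+ 2.
have D0 : 0 <= D by apply: sumr_ge0 => v _; apply: sqr_ge0.
(* A step of length t changes the squared norm N by at most
   - 2 * t * N + t ^+ 2 * D; this t makes that negative and is at most 1. *)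
pose t := N / (N + D).
have ND : 0 < N + D by lra.
have t0 : 0 < t by rewrite divr_gt0.
have t1 : t <= 1 by rewrite /t ler_pdivrMr // mul1r lerDl.
have tD : t * D <= N.
  by rewrite /t mulrAC ler_pdivrMr // ler_wpM2l // lerDr.
pose g T := (1 - t) * f T + t * (mu * (T == S)%:R).
have covg v : covered C g v = covered C f v + t * d v.
  rewrite /covered big_split /= -!mulr_sumr -/(covered C f v).
  have -> : \sum_(T in C | v \in T) (T == S)%:R = (v \in S)%:R :> R.
    have [vS|vS] := boolP (v \in S); last first.
      by rewrite big1 // => T /andP[_ vT]; case: eqP vT vS => // -> ->.
    rewrite (bigD1 S) ?SC //= eqxx big1 ?addr0 // => T /andP[_].
    by move/negbTE->.
  rewrite /d; ring.
(* Since a <= Num.max 0 a, the positive part of a - t * d is at most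
   `|Num.max 0 a - t * d|, which turns the deficit of g into a quadratic. *)
have gN : \sum_v deficit C w g v ^+ 2 <= N - 2 * t * \sum_v y v * d v + t ^+ 2 * D.
  rewrite /N /D !mulr_sumr -sumrB -big_split /=; apply: ler_sum => v _.
  have -> : y v ^+ 2 - 2 * t * (y v * d v) + t ^+ 2 * d v ^+ 2
    = `|y v - t * d v| ^+ 2 by rewrite real_normK ?num_real //; ring.
  rewrite ler_sqr ?nnegrE ?normr_ge0 ?le_max ?lexx //.
  rewrite /deficit ge_max normr_ge0 covg /=; apply: le_trans (ler_norm _).
  by rewrite opprD addrA lerD2r /y /deficit le_max lexx orbT.
(* y v is 0 unless y v = w v - covered C f v, so N is the sum of the products
   y v * (w v - covered C f v). *)
have yd : N <= \sum_v y v * d v.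
  have -> : \sum_v y v * d v =
      mu * \sum_(v in S) y v - \sum_v y v * covered C f v.
    rewrite mulr_sumr [X in _ = X - _]big_mkcond -sumrB; apply: eq_bigr => v _.
    by rewrite /d; case: (v \in S); rewrite /=; ring.
  have -> : N = \sum_v y v * w v - \sum_v y v * covered C f v.
    rewrite -sumrB; apply: eq_bigr => v _; rewrite -mulrBr expr2.
    by rewrite /y /deficit; case: leP => _; rewrite ?mul0r.
  by rewrite lerD2r.
have g0 T : 0 <= g T.
  apply: addr_ge0; first by rewrite mulr_ge0 ?subr_ge0.
  by apply: mulr_ge0; [exact: ltW | rewrite mulr_ge0 ?ler0n].
have gmu T : g T <= mu.
  have bmu : mu * (T == S)%:R <= mu by case: eqP; rewrite ?mulr1 ?mulr0.
  have := ler_wpM2l (ltW t0) bmu.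
  have : (1 - t) * f T <= (1 - t) * mu by rewrite ler_wpM2l ?subr_ge0.
  rewrite /g; lra.
have gw : weight C g <= mu.
  rewrite /weight big_split /= -!mulr_sumr.
  have -> : \sum_(T in C) (T == S)%:R = 1 :> R.
    by rewrite (bigD1 S) //= eqxx big1 ?addr0 // => T /andP[_ /negbTE->].
  have : (1 - t) * weight C f <= (1 - t) * mu by rewrite ler_wpM2l ?subr_ge0.
  rewrite /weight; lra.
have := fmin g g0 gmu gw; rewrite -/y -/N => /le_trans/(_ gN).
have : t * N <= t * \sum_v y v * d v by rewrite ler_wpM2l // ltW.
have : t * (t * D) <= t * N by rewrite ler_wpM2l // ltW.
have : 0 < t * N by rewrite mulr_gt0.
rewrite expr2; lra.
Qed.

End Duality.

(** * The rank bound and the greedy algorithm *)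

Section Matroid.
Variables (R : realType) (V : finType).
Implicit Types (C M : {set {set V}}) (S T U : {set V}) (w y : V -> R).
Implicit Types (f : {set V} -> R) (lam mu : R).

(** An independent subset of U larger than S would give, by exchange, an element
    of U that extends S; so each color class of a fractional coloring of M
    meets U in at most #|S| elements.  Summing the covering conditions over U
    for an optimal coloring counts each class at most #|S| times. *)
Lemma chi_star_rank_bound M w S U : is_matroid M -> loopless M ->
  (forall v, 0 <= w v) -> S \in M ->
  (forall v, v \in U -> v \notin S -> (v |: S)%SET \notin M) ->
  \sum_(v in U) w v <= chi_star M w * #|S|%:R.
Proof.
move=> [[_ down] exch] Ml w0 SM spanU.
have [f0 f0C] := loopless_frac_coloring w0 Ml.
have [f [[fge0 fcov] <- _]] := chi_star_min f0C.
apply: le_trans (ler_sum _ (fun v _ => fcov v)) _.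
under eq_bigr do rewrite big_mkcondr.
rewrite exchange_big /weight mulr_suml; apply: ler_sum => I IM.
rewrite -big_mkcondr (eq_bigl [in (U :&: I)%SET]) => [|v]; last by rewrite inE.
rewrite sumr_const -(mulr_natr (f I)).
apply: ler_wpM2l; first exact: fge0.
rewrite ler_nat leqNgt; apply/negP => ltSI.
have UIM : (U :&: I)%SET \in M by apply: down IM; apply: subsetIr.
have [x /setDP[/setIP[xU _] xS] xSM] := exch _ _ SM UIM ltSI.
by have := spanU x xU xS; rewrite xSM.
Qed.

(** An element of T that cannot be added to S is rejected by at least one of the
    matroids; the rank bound applies to each of the k sets of elements rejected
    by the same matroid, together with the part of S in T. *)
Lemma maximal_common_bound (k : nat) (M : 'I_k -> {set {set V}}) w lam S T :
  (0 < k)%N -> (forall i, is_matroid (M i)) -> (forall i, loopless (M i)) ->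
  (forall v, 0 <= w v) -> (forall i, chi_star (M i) w <= lam) ->
  S \in (\bigcap_(i < k) M i)%SET ->
  (forall v, v \in T -> v \notin S -> (v |: S)%SET \notin (\bigcap_(i < k) M i)%SET) ->
  \sum_(v in T) w v <= k%:R * lam * #|S|%:R.
Proof.
move=> k0 Mm Ml w0 lamM /bigcapP SM maxS.
pose U i := [set v in T | (v \in S) || ((v |: S)%SET \notin M i)]%SET.
have TU v : v \in T -> exists i, v \in U i.
  move=> vT; have [vS|vS] := boolP (v \in S).
    (* Elements of S lie in every U i; one i exists because 0 < k. *)
    by exists (Ordinal k0); rewrite inE vT vS.
  have /existsP[i vi] : [exists i, (v |: S)%SET \notin M i].
    rewrite -negb_forall; apply: contra (maxS v vT vS) => /forallP vM.
    by apply/bigcapP => i _.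
  by exists i; rewrite inE vT vi orbT.
apply: (@le_trans _ _ (\sum_(i < k) \sum_(v in U i) w v)).
  under [leRHS]eq_bigr do rewrite big_mkcond.
  rewrite exchange_big /= big_mkcond; apply: ler_sum => v _.
  have s0 (i : 'I_k) : 0 <= (if v \in U i then w v else 0) by case: ifP.
  case: ifPn => [/TU[i vi]|_]; last exact: sumr_ge0.
  by rewrite (bigD1 i) //= vi lerDl sumr_ge0.
have -> : k%:R * lam * #|S|%:R = \sum_(i < k) lam * #|S|%:R.
  by rewrite sumr_const card_ord -mulrA mulr_natl.
apply: ler_sum => i _.
apply: (@le_trans _ _ (chi_star (M i) w * #|S|%:R)); last first.
  by rewrite ler_wpM2r ?ler0n.
apply: chi_star_rank_bound => // [|v]; first exact: SM.
by rewrite inE => /andP[_ /orP[->|]].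
Qed.

(** The induction on T removes an element u where y is least, that is, it undoes
    the last greedy step.  The shift c is what makes it go through: for c = y u
    the element u contributes nothing to either side, so the bound for T :\ u
    passes to T, and lowering c from y u to a smaller value adds (y u - c) times
    the bound w(T) <= mu * #|S|, as S is maximal in T.  This is Abel
    summation along the greedy order. *)
Lemma greedy_bound C w y mu T : set0 \in C ->
  (forall I J : {set V}, I \subset J -> J \in C -> I \in C) ->
  (forall S U, S \in C -> S \subset U ->
     (forall v, v \in U -> v \notin S -> (v |: S)%SET \notin C) ->
     \sum_(v in U) w v <= mu * #|S|%:R) ->
  exists S, [/\ S \in C, S \subset T,
    forall v, v \in T -> v \notin S -> (v |: S)%SET \notin C &
    forall c, (forall v, v \in T -> c <= y v) ->
      \sum_(v in T) (y v - c) * w v <= mu * \sum_(v in S) (y v - c)].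
Proof.
move=> C0 Cdown bound; have [n] := ubnP #|T|; elim: n T => // n IH T ltTn.
have [->|[u0 u0T]] := set_0Vmem T.
  by exists set0; split=> // [v|c _]; rewrite ?inE // !big_set0 mulr0.
have [u uT umin] : exists2 u, u \in T & forall v, v \in T -> y u <= y v.
  by case: (Order.TotalTheory.arg_minP y u0T) => u; exists u.
have [S [SC ST Smax Sle]] : exists S, [/\ S \in C, S \subset T :\ u,
    forall v, v \in T :\ u -> v \notin S -> (v |: S)%SET \notin C &
    forall c, (forall v, v \in T :\ u -> c <= y v) ->
      \sum_(v in T :\ u) (y v - c) * w v <= mu * \sum_(v in S) (y v - c)].
  by apply: IH; move: ltTn; rewrite (cardsD1 u T) uT ltnS.
have uS : u \notin S by apply/negP => /(subsetP ST); rewrite !inE eqxx.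
have ST' : S \subset T := subset_trans ST (subD1set T u).
pose S' := if (u |: S)%SET \in C then (u |: S)%SET else S.
have SS' : S \subset S' by rewrite /S'; case: ifP => // _; apply: subsetUr.
have S'C : S' \in C by rewrite /S'; case: ifP.
have S'T : S' \subset T by rewrite /S'; case: ifP => // _; rewrite subUset sub1set uT.
have S'max v : v \in T -> v \notin S' -> (v |: S')%SET \notin C.
  move=> vT vS'; have [vu|vu] := eqVneq v u.
    by move: vS'; rewrite vu /S'; case: ifPn => //; rewrite setU11.
  apply: contra (Smax v _ _); last first.
  - exact: contra (subsetP SS' v) vS'.
  - by rewrite !inE vu.
  - by apply: Cdown; apply: setUS.
exists S'; split=> // c cle.
have -> : \sum_(v in T) (y v - c) * w v =
    \sum_(v in T :\ u) (y v - y u) * w v + (y u - c) * \sum_(v in T) w v.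
  rewrite mulr_sumr [in RHS](big_setD1 u uT) [in LHS](big_setD1 u uT) /=.
  rewrite addrCA; congr (_ + _); rewrite -big_split /=.
  by apply: eq_bigr => v _; ring.
have -> : \sum_(v in S') (y v - c) =
    \sum_(v in S) (y v - y u) + (y u - c) * #|S'|%:R.
  have -> : \sum_(v in S) (y v - y u) = \sum_(v in S') (y v - y u).
    by rewrite /S'; case: ifP => // _; rewrite big_setU1 //= subrr add0r.
  rewrite mulr_natr -sumr_const -big_split; apply: eq_bigr => v _ /=; ring.
(* The first terms compare by induction with shift y u, the second by maximality. *)
rewrite mulrDr lerD //.
  by apply: Sle => v /setD1P[_]; apply: umin.
by rewrite mulrCA ler_wpM2l ?subr_ge0 ?cle // bound.
Qed.

End Matroid.

Theorem corollary10p15 (R : realType) (V : finType) (k : nat) (hk : (1 <= k)%N)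
    (M : 'I_k -> {set {set V}})
    (M_matroid : forall i : 'I_k, is_matroid (M i))
    (M_loopless : forall i : 'I_k, loopless (M i))
    (w : V -> R) (w_ge0 : forall v : V, 0 <= w v) :
  chi_star (\bigcap_(i < k) M i)%SET w <=
    k%:R * \big[Num.max/0]_(i < k) chi_star (M i) w.
Proof.
set lam := \big[Num.max/0]_(i < k) _; set C := (\bigcap_(i < k) M i)%SET.
have lamM i : chi_star (M i) w <= lam by apply: le_bigmax.
have lam0 : 0 <= lam := le_trans (chi_star_ge0 _ _) (lamM (Ordinal hk)).
have C_down (I J : {set V}) : I \subset J -> J \in C -> I \in C.
  move=> IJ /bigcapP JM; apply/bigcapP => i _.
  by have [[_ down] _] := M_matroid i; apply: down IJ (JM i isT).
have C0 : set0 \in C.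
  apply/bigcapP => i _; have [[/set0Pn[I IM] down] _] := M_matroid i.
  exact: down (sub0set I) IM.
apply: chi_star_le_dual => [|y y0]; first by rewrite mulr_ge0.
have [S U SC SU Smax|S [SC _ _ /(_ 0)]] :=
    @greedy_bound R V C w y (k%:R * lam) [set: V]%SET C0 C_down.
  exact: maximal_common_bound Smax.
move=> /(_ (fun v _ => y0 v)) Sle; exists S => //.
move: Sle; under eq_bigr do rewrite subr0.
under [in leRHS]eq_bigr do rewrite subr0.
by rewrite (eq_bigl xpredT) // => v; rewrite inE.
Qed.
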